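(* Let $\mathcal{C}$ be a clutter and let $A$ be the $n\times s$ matrix with columns $v_1,\ldots,v_s$. Then $$I(X)=\big(\{t^{a^+}-t^{a^-}: a\in\mathbb{Z}^s,\ Aa^+\equiv Aa^-\ (\mathrm{mod}\ q-1),\ |a^+|=|a^-|\}\big),$$ where $a^+,a^-\in\mathbb{N}^s$ are the positive and negative parts of $a$ ($a=a^+-a^-$, disjoint supports), the congruence is entrywise, and $|b|=b_1+\cdots+b_s$.
   Context: Let $K=\mathbb{F}_q$ be a finite field with $q\neq 2$ elements. A clutter $\mathcal{C}$ with vertex set $\{y_1,\ldots,y_n\}$ is a family of subsets (edges) of this set such that no edge is contained in another; let its edges be $f_1,\ldots,f_s$ ($s\geq 2$) with characteristic vectors $v_i=\sum_{y_j\in f_i}e_j\in\{0,1\}^n$. For $x\in K^n$ write $x^{v_i}=\prod_j x_j^{v_{ij}}$. Let $X=\{[(x^{v_1},\ldots,x^{v_s})]\in\mathbb{P}^{s-1}: x\in (K^* )^n\}$, let $S=K[t_1,\ldots,t_s]$ with the standard grading, and let $I(X)$ be the ideal of $S$ generated by the homogeneous polynomials vanishing on $X$. *)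

(* Defs.v *)
(* No multivariate polynomial library is installed, so we
   define a minimal representation of K[t_1..t_s]: a polynomial is a finite
   list of terms (coefficient, exponent vector); two lists denote the same
   polynomial iff they have the same coefficient function [mcoef]. *)
From HB Require Import structures.
From mathcomp Require Import all_boot all_order all_algebra all_field.
Set Implicit Arguments. Unset Strict Implicit. Unset Printing Implicit Defensive.
Import Order.TTheory GRing.Theory Num.Theory.
Local Open Scope ring_scope.

Definition monom (s : nat) := {ffun 'I_s -> nat}.

Definition mpoly (R : nzRingType) (s : nat) := seq (R * monom s).

Section MPoly.
Variables (R : comNzRingType) (s : nat).

Definition mcoef (p : mpoly R s) (m : monom s) : R :=
  \sum_(u <- p | u.2 == m) u.1.

Definition meq (p q : mpoly R s) : Prop := forall m, mcoef p m = mcoef q m.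

Definition madd (p q : mpoly R s) : mpoly R s := p ++ q.

Definition mmul (p q : mpoly R s) : mpoly R s :=
  [seq ((u.1 * w.1)%R, [ffun i => (u.2 i + w.2 i)%N] : monom s)
  | u : R * monom s <- p, w : R * monom s <- q].

Definition mdeg (m : monom s) : nat := (\sum_i m i)%N.

Definition meval (p : mpoly R s) (t : 'I_s -> R) : R :=
  \sum_(u <- p) u.1 * \prod_i t i ^+ u.2 i.

Definition mhomog (p : mpoly R s) : Prop :=
  exists d, forall m, mcoef p m != 0 -> mdeg m = d.

Definition mmonom (m : monom s) : mpoly R s := [:: (1, m)].

Definition mbinom (b c : monom s) : mpoly R s := [:: (1, b); (-1, c)].

Definition in_ideal (G : mpoly R s -> Prop) (f : mpoly R s) : Prop :=
  exists l : seq (mpoly R s * mpoly R s),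
    (forall u, u \in l -> G u.2) /\
    meq f (foldr (fun u acc => madd (mmul u.1 u.2) acc) [::] l).

End MPoly.

Definition is_clutter (n s : nat) (E : 'I_s -> {set 'I_n}) : Prop :=
  forall i j : 'I_s, i != j -> ~~ (E i \subset E j).

Definition incidence (n s : nat) (E : 'I_s -> {set 'I_n}) : 'M[nat]_(n, s) :=
  \matrix_(j < n, i < s) nat_of_bool (j \in E i).

Definition xpow (K : fieldType) (n s : nat) (E : 'I_s -> {set 'I_n})
  (x : 'I_n -> K) (i : 'I_s) : K := \prod_(j in E i) x j.

(* I(X): generated by the homogeneous polynomials vanishing on
   X = {[(x^{v_1},...,x^{v_s})] : x in (K^* )^n}. *)
Definition IX_gen (K : fieldType) (n s : nat) (E : 'I_s -> {set 'I_n})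
  (F : mpoly K s) : Prop :=
  mhomog F /\
  forall x : 'I_n -> K, (forall j, x j != 0) -> meval F (xpow E x) = 0.

Definition vanishing_ideal (K : fieldType) (n s : nat) (E : 'I_s -> {set 'I_n})
  : mpoly K s -> Prop := in_ideal (IX_gen E).

Definition posp (s : nat) (a : 'I_s -> int) : monom s :=
  [ffun i => if (0 <= a i)%R then absz (a i) else 0%N].
Definition negp (s : nat) (a : 'I_s -> int) : monom s :=
  [ffun i => if (0 <= a i)%R then 0%N else absz (a i)].

Definition matvec (n s : nat) (A : 'M[nat]_(n, s)) (b : monom s) (j : 'I_n) : nat :=
  (\sum_i A j i * b i)%N.

Definition binom_gen (K : finFieldType) (n s : nat) (E : 'I_s -> {set 'I_n})
  (g : mpoly K s) : Prop :=
  exists a : 'I_s -> int,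
    (forall j : 'I_n, matvec (incidence E) (posp a) j
                      = matvec (incidence E) (negp a) j %[mod #|K|.-1]) /\
    mdeg (posp a) = mdeg (negp a) /\
    g = mbinom K (posp a) (negp a).

(* Main.v *)
Require Import Defs.
From HB Require Import structures.
From mathcomp Require Import all_boot all_order all_algebra all_field.
Set Implicit Arguments. Unset Strict Implicit. Unset Printing Implicit Defensive.
Import Order.TTheory GRing.Theory Num.Theory.
Local Open Scope ring_scope.

(* Call exponent vectors m, m' in N^s toric-equivalent when |m| = |m'| and
   A m = A m' (mod q-1), and call a polynomial balanced when, on every
   equivalence class, its coefficients sum to zero.  The proof shows that
   both ideals of the statement are the ideal of balanced polynomials:
   - balanced polynomials are closed under sums and under multiplication
     by arbitrary polynomials, so they form an ideal;
   - a balanced polynomial is a combination of the binomial generators: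
     choosing a representative r(m) of each class, P = sum_m c_m t^m equals
     sum_m c_m t^{min(m, r(m))} (t^{a+} - t^{a-}) with a = m - r(m);
   - the homogeneous polynomials vanishing on X are balanced: averaging
     F(x^{v_1},...,x^{v_s}) x^{-A m0} over the torus (K^* )^n, the power sums
     sum_{y in K^* } y^k (equal to -1 if q-1 | k and to 0 otherwise) isolate
     the coefficients of the t^m with A m = A m0 (mod q-1);
   - conversely the binomial generators are homogeneous and vanish on X,
     because y^{q-1} = 1 on K^*.
   The first two steps hold over any commutative ring, for any modulus and
   any matrix A; the last two for any nonnegative integer matrix A. *)

Section FiniteFieldPowerSums.
Variable K : finFieldType.

(* q = 0 in K: translation by 1 permutes K, so it fixes the sum of all
   elements of K, which forces q * 1 = 0. *)
Lemma natr_card : (#|K|%:R : K) = 0.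
Proof.
have shift : \sum_(y : K) y = \sum_(y : K) (1 + y).
  by rewrite (reindex_inj (addrI (1 : K))).
by move/eqP: shift; rewrite big_split /= sumr_const -subr_eq subrr => /eqP.
Qed.

Lemma card_pred_gt0 : (0 < #|K|.-1)%N.
Proof. by rewrite -subn1 subn_gt0 finNzRing_gt1. Qed.

Lemma natr_card_pred : ((#|K|.-1)%:R : K) = -1.
Proof.
apply/eqP; rewrite -addr_eq0 natr1 prednK ?natr_card //.
exact: ltnW (finNzRing_gt1 K).
Qed.

Lemma expf_card_pred (x : K) : x != 0 -> x ^+ #|K|.-1 = 1.
Proof.
move=> xn0; apply: (mulfI xn0); rewrite mulr1 -exprS prednK ?expf_card //.
exact: ltnW (finNzRing_gt1 K).
Qed.

Lemma expf_modn (x : K) k : x != 0 -> x ^+ k = x ^+ (k %% #|K|.-1).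
Proof.
move=> xn0; rewrite {1}(divn_eq k #|K|.-1) exprD mulnC exprM expf_card_pred //.
by rewrite expr1n mul1r.
Qed.

(* If q-1 does not divide k, some nonzero c has c^k <> 1: otherwise the
   q-1 units would all be roots of X^(k mod q-1) - 1, of smaller degree. *)
Lemma exists_unit_exp_neq1 k : ~~ (#|K|.-1 %| k)%N ->
  exists2 c : K, c != 0 & c ^+ k != 1.
Proof.
rewrite /dvdn => k_mod_neq0.
have [/existsP[c /andP[cn0 ck]] | /existsPn all_one] :=
  boolP [exists c : K, (c != 0) && (c ^+ k != 1)]; first by exists c.
pose r := (k %% #|K|.-1)%N.
have p_neq0 : ('X^r - 1 : {poly K}) != 0.
  by rewrite -size_poly_eq0 -polyC1 size_XnsubC // lt0n.
have units_roots : all (root ('X^r - 1)) (enum (predC1 (0 : K))).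
  apply/allP=> y; rewrite mem_enum !inE => yn0.
  move: (all_one y); rewrite yn0 /= negbK => /eqP y_k.
  by rewrite /root !hornerE -expf_modn // y_k subrr.
have := max_poly_roots p_neq0 units_roots (enum_uniq _).
rewrite -cardE cardC1 -polyC1 size_XnsubC ?lt0n // ltnS leqNgt.
by rewrite ltn_pmod ?card_pred_gt0.
Qed.

Definition unit_power_sum k : K := \sum_(y : K | y != 0) y ^+ k.

Lemma unit_power_sumE k :
  unit_power_sum k = if (#|K|.-1 %| k)%N then -1 else 0.
Proof.
case: ifP => [dvd_k | /negbT ndvd_k].
  rewrite /unit_power_sum (eq_bigr (fun _ => 1)); last first.
    by move=> y yn0; rewrite expf_modn // (eqP dvd_k) expr0.
  by rewrite (eq_bigl (mem (predC1 0))) // sumr_const cardC1 natr_card_pred.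
have [c cn0 ck_neq1] := exists_unit_exp_neq1 ndvd_k.
have scaled : unit_power_sum k = c ^+ k * unit_power_sum k.
  rewrite /unit_power_sum mulr_sumr (reindex_inj (mulfI cn0)).
  apply: eq_big => y; first by rewrite mulf_eq0 negb_or cn0.
  by rewrite exprMn.
have : (c ^+ k - 1) * unit_power_sum k = 0 by rewrite mulrBl mul1r -scaled subrr.
by move/eqP; rewrite mulf_eq0 subr_eq0 (negbTE ck_neq1) /= => /eqP.
Qed.

End FiniteFieldPowerSums.

Section PolynomialTerms.
Variables (R : comNzRingType) (s : nat).
Implicit Types (p q P : mpoly R s) (m : monom s).

Lemma mcoef_cat p q m : mcoef (p ++ q) m = mcoef p m + mcoef q m.
Proof. by rewrite /mcoef big_cat. Qed.

Lemma mcoef_pair (a c : R) (b e m : monom s) :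
  mcoef [:: (a, b); (c, e)] m =
  (if b == m then a else 0) + (if e == m then c else 0).
Proof.
rewrite /mcoef !big_cons big_nil /=.
by case: (b == m); case: (e == m); rewrite ?addr0 ?add0r.
Qed.

Definition mcomb (l : seq (mpoly R s * mpoly R s)) : mpoly R s :=
  foldr (fun u acc => madd (mmul u.1 u.2) acc) [::] l.

Lemma mcoef_mcomb l m : mcoef (mcomb l) m = \sum_(u <- l) mcoef (mmul u.1 u.2) m.
Proof.
elim: l => [|u l IHl]; first by rewrite big_nil /mcoef big_nil.
by rewrite big_cons /= /madd mcoef_cat IHl.
Qed.

Lemma in_ideal_meq (G : mpoly R s -> Prop) f P :
  in_ideal G P -> meq f P -> in_ideal G f.
Proof. by move=> [l [Gl eqPl]] eqfP; exists l; split=> // m; rewrite eqfP eqPl. Qed.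

Lemma in_ideal_mono (G G' : mpoly R s -> Prop) f :
  (forall g, G g -> G' g) -> in_ideal G f -> in_ideal G' f.
Proof. by move=> GG' [l [Gl eqf]]; exists l; split=> // u /Gl /GG'. Qed.

Lemma sum_terms_mcoef (Q : pred (monom s)) P :
  \sum_(u <- P | Q u.2) u.1 = \sum_(m <- undup [seq u.2 | u <- P] | Q m) mcoef P m.
Proof.
symmetry; rewrite /mcoef (exchange_big_dep (fun u => Q u.2)) /=; last first.
  by move=> m u Qm /eqP ->.
rewrite big_seq_cond [RHS]big_seq_cond; apply: eq_bigr => u /andP[uP Qu].
rewrite (eq_bigl (pred1 u.2)); last first.
  by move=> m /=; rewrite eq_sym andb_idl // => /eqP ->.
rewrite big_const_seq count_uniq_mem ?undup_uniq // mem_undup map_f //=.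
by rewrite addr0.
Qed.

Lemma eq_meval P (t t' : 'I_s -> R) : t =1 t' -> meval P t = meval P t'.
Proof. by move=> eq_t; apply: eq_bigr => u _; under eq_bigr do rewrite eq_t. Qed.

End PolynomialTerms.

Section ExponentVectors.
Variable s : nat.
Implicit Types (a b c : monom s).

Definition maddm a b : monom s := [ffun i => (a i + b i)%N].
Definition mminm b c : monom s := [ffun i => minn (b i) (c i)].

Definition mdiff b c : 'I_s -> int := fun i => (b i)%:Z - (c i)%:Z.

Lemma mdegD a b : mdeg (maddm a b) = (mdeg a + mdeg b)%N.
Proof. by rewrite /mdeg -big_split; apply: eq_bigr => i _; rewrite ffunE. Qed.

Lemma posp_mdiff b c : maddm (mminm b c) (posp (mdiff b c)) = b.
Proof.
apply/ffunP => i; rewrite !ffunE /mdiff subr_ge0 lez_nat.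
case: leqP => [c_le_b | _]; last by rewrite addn0.
by rewrite distnEl // subnKC.
Qed.

Lemma negp_mdiff b c : maddm (mminm b c) (negp (mdiff b c)) = c.
Proof.
apply/ffunP => i; rewrite !ffunE /mdiff subr_ge0 lez_nat.
case: leqP => [_ | b_lt_c]; first by rewrite addn0.
by rewrite distnEr ?subnKC // ltnW.
Qed.

End ExponentVectors.

Section ToricEquivalence.
Variables (d n s : nat) (A : 'M[nat]_(n, s)).
Implicit Types (b c m : monom s).

Lemma matvecD (u w : monom s) j :
  matvec A (maddm u w) j = (matvec A u j + matvec A w j)%N.
Proof.
by rewrite /matvec -big_split; apply: eq_bigr => i _; rewrite ffunE mulnDr.
Qed.

Definition toric_congr m m' : bool :=
  [forall j, matvec A m j == matvec A m' j %[mod d]].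

Definition toric_equiv m m' : bool := (mdeg m == mdeg m') && toric_congr m m'.

Lemma toric_equiv_refl m : toric_equiv m m.
Proof. by rewrite /toric_equiv eqxx; apply/forallP. Qed.

Lemma toric_equiv_sym m m' : toric_equiv m m' = toric_equiv m' m.
Proof.
by rewrite /toric_equiv eq_sym; congr (_ && _); apply: eq_forallb => j; rewrite eq_sym.
Qed.

Lemma toric_equiv_trans m2 m1 m3 :
  toric_equiv m1 m2 -> toric_equiv m2 m3 -> toric_equiv m1 m3.
Proof.
move=> /andP[/eqP deg12 /forallP congr12] /andP[/eqP deg23 /forallP congr23].
rewrite /toric_equiv deg12 deg23 eqxx /=; apply/forallP => j.
by rewrite (eqP (congr12 j)) (eqP (congr23 j)).
Qed.

Lemma toric_equiv_class m m' m0 :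
  toric_equiv m' m0 -> toric_equiv m m0 = toric_equiv m m'.
Proof.
move=> equiv_m'; apply/idP/idP => equiv_m; last exact: toric_equiv_trans equiv_m'.
by apply: toric_equiv_trans equiv_m _; rewrite toric_equiv_sym.
Qed.

(* translation invariance: both conditions are additive *)
Lemma toric_equiv_addl (u w w' : monom s) :
  toric_equiv (maddm u w) (maddm u w') = toric_equiv w w'.
Proof.
rewrite /toric_equiv !mdegD eqn_add2l; congr (_ && _).
by apply: eq_forallb => j; rewrite !matvecD eqn_modDl.
Qed.

Definition balanced (R : comNzRingType) (P : mpoly R s) : Prop :=
  forall m0, \sum_(t <- P | toric_equiv t.2 m0) t.1 = 0.

Section Balanced.
Variable R : comNzRingType.
Implicit Types (h P Q : mpoly R s).

Lemma balanced_cat P Q : balanced P -> balanced Q -> balanced (P ++ Q).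
Proof. by move=> balP balQ m0; rewrite big_cat /= balP balQ addr0. Qed.

(* Multiplying by one term t^u maps classes to classes bijectively, so
   h * P is balanced whenever P is. *)
Lemma balanced_mmul h P : balanced P -> balanced (mmul h P).
Proof.
move=> balP m0; rewrite /mmul big_mkcond big_allpairs_dep /= big1 // => t _.
rewrite -big_mkcond /= -mulr_sumr.
have [/hasP[w _ equiv_w] | no_term] :=
  boolP (has (fun w : R * monom s => toric_equiv (maddm t.2 w.2) m0) P).
  rewrite (eq_bigl (fun v : R * monom s => toric_equiv v.2 w.2)) ?balP ?mulr0 //.
  by move=> v /=; rewrite (toric_equiv_class _ equiv_w) toric_equiv_addl.
by rewrite big_hasC ?mulr0.
Qed.

Lemma balanced_mcomb (l : seq (mpoly R s * mpoly R s)) :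
  (forall hg, hg \in l -> balanced hg.2) -> balanced (mcomb l).
Proof.
elim: l => [|hg l IHl] bal_l; first by move=> m0; rewrite big_nil.
apply: balanced_cat; first by apply/balanced_mmul/bal_l; rewrite mem_head.
by apply: IHl => v vl; apply: bal_l; rewrite in_cons vl orbT.
Qed.

End Balanced.

Definition toric_binomial (R : comNzRingType) (g : mpoly R s) : Prop :=
  exists a : 'I_s -> int,
    toric_equiv (posp a) (negp a) /\ g = mbinom R (posp a) (negp a).

Section BalancedBinomials.
Variable R : comNzRingType.

(* For b ~ c, t^b - t^c = t^{min(b,c)} (t^{a+} - t^{a-}) with a = b - c,
   and the second factor is a toric binomial. *)
Lemma toric_binomial_mdiff b c :
  toric_equiv b c -> toric_binomial (mbinom R (posp (mdiff b c)) (negp (mdiff b c))).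
Proof.
move=> equiv_bc; exists (mdiff b c); split=> //.
by rewrite -(toric_equiv_addl (mminm b c)) posp_mdiff negp_mdiff.
Qed.

Lemma mcoef_shifted_binomial (a : R) b c m :
  mcoef (mmul [:: (a, mminm b c)] (mbinom R (posp (mdiff b c)) (negp (mdiff b c)))) m
  = (if b == m then a else 0) - (if c == m then a else 0).
Proof.
have -> : mmul [:: (a, mminm b c)] (mbinom R (posp (mdiff b c)) (negp (mdiff b c)))
  = [:: (a * 1, maddm (mminm b c) (posp (mdiff b c)));
        (a * -1, maddm (mminm b c) (negp (mdiff b c)))] by [].
rewrite posp_mdiff negp_mdiff mcoef_pair mulr1 mulrN1.
by case: (c == m); rewrite ?oppr0.
Qed.

Section ClassRepresentatives.
Variable P : mpoly R s.

Definition class_rep m : monom s :=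
  (nth (0, [ffun=> 0%N]) P (find (fun t : R * monom s => toric_equiv t.2 m) P)).2.

Lemma class_rep_equiv t : t \in P -> toric_equiv (class_rep t.2) t.2.
Proof.
move=> tP; have has_class : has (fun w : R * monom s => toric_equiv w.2 t.2) P.
  by apply/hasP; exists t => //; apply: toric_equiv_refl.
exact: nth_find _ has_class.
Qed.

Lemma class_rep_eq m m' : toric_equiv m m' -> class_rep m = class_rep m'.
Proof.
move=> equiv_mm'; rewrite /class_rep.
rewrite (eq_find (a2 := fun t : R * monom s => toric_equiv t.2 m')) //.
by move=> t /=; rewrite (toric_equiv_class _ equiv_mm').
Qed.

Lemma class_repE t w : t \in P -> w \in P ->
  (class_rep t.2 == class_rep w.2) = toric_equiv t.2 w.2.
Proof.
move=> tP wP; apply/eqP/idP => [same_rep | equiv_tw]; last exact: class_rep_eq.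
apply: (@toric_equiv_trans (class_rep t.2)).
  by rewrite toric_equiv_sym class_rep_equiv.
by rewrite same_rep class_rep_equiv.
Qed.

(* the terms with a given representative form a class, so their
   coefficients cancel when P is balanced *)
Lemma balanced_rep_sum m : balanced P -> \sum_(t <- P | class_rep t.2 == m) t.1 = 0.
Proof.
move=> balP.
have [/hasP[w wP /eqP rep_w] | no_rep] :=
  boolP (has (fun t : R * monom s => class_rep t.2 == m) P); last by rewrite big_hasC.
rewrite big_seq_cond (eq_bigl (fun t => (t \in P) && toric_equiv t.2 w.2)).
  by rewrite -big_seq_cond; apply: balP.
by move=> t /=; case tP: (t \in P); rewrite //= -rep_w class_repE.
Qed.

(* A balanced polynomial lies in the ideal of the toric binomials:
   P = sum_t c_t t^{min(m_t, r_t)} (t^{a+} - t^{a-}) with a = m_t - r_t and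
   r_t the representative of the class of m_t. *)
Lemma balanced_in_ideal : balanced P -> in_ideal (@toric_binomial R) P.
Proof.
move=> balP.
pose term_multiple (t : R * monom s) : mpoly R s * mpoly R s :=
  ([:: (t.1, mminm t.2 (class_rep t.2))],
   mbinom R (posp (mdiff t.2 (class_rep t.2))) (negp (mdiff t.2 (class_rep t.2)))).
exists (map term_multiple P); split.
  move=> _ /mapP[t tP ->]; apply: toric_binomial_mdiff.
  by rewrite toric_equiv_sym class_rep_equiv.
move=> m; rewrite (mcoef_mcomb (map term_multiple P)) big_map.
under eq_bigr do rewrite mcoef_shifted_binomial.
by rewrite sumrB -!big_mkcond /= balanced_rep_sum // subr0.
Qed.

End ClassRepresentatives.
End BalancedBinomials.
End ToricEquivalence.

(* (d-1) e = -e (mod d), so d divides a + (d-1) e iff a = e (mod d); this is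
   the exponent arithmetic of x^{A b} x^{-A m0} *)
Lemma dvdn_add_pred_mul d a e : (0 < d)%N ->
  (d %| a + d.-1 * e)%N = (a == e %[mod d]).
Proof.
move=> d_gt0; rewrite /dvdn -(eqn_modDr (d.-1 * e)) -mulSn prednK //.
by rewrite modnMr.
Qed.

Section TorusSums.
Variables (K : finFieldType) (n s : nat) (A : 'M[nat]_(n, s)).

Definition torus_point (x : 'I_n -> K) (i : 'I_s) : K := \prod_j x j ^+ A j i.

Lemma torus_point_monomial (x : 'I_n -> K) (b : monom s) :
  \prod_i torus_point x i ^+ b i = \prod_j x j ^+ matvec A b j.
Proof.
rewrite /matvec; under [RHS]eq_bigr => j _ do rewrite expr_sum.
rewrite exchange_big /=; apply: eq_bigr => i _.
by rewrite /torus_point -prodrXl; apply: eq_bigr => j _; rewrite exprM.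
Qed.

Lemma torus_monomial_sum (e : 'I_n -> nat) :
  \sum_(x : {ffun 'I_n -> K} | [forall j, x j != 0]) \prod_j x j ^+ e j
  = \prod_j unit_power_sum K (e j).
Proof.
rewrite /unit_power_sum; under [RHS]eq_bigr do rewrite big_mkcond /=.
rewrite bigA_distr_bigA big_mkcond /=; apply: eq_bigr => x _.
have [/forallP x_unit | /forallPn[j xj0]] := boolP [forall j, x j != 0].
  by apply: eq_bigr => j _; rewrite x_unit.
by rewrite (bigD1 j) //= (negbTE xj0) mul0r.
Qed.

(* orthogonality of characters: averaging x^{A b} x^{-A m0} over the torus
   detects A b = A m0 (mod q-1); x^{-1} is x^{q-2} on units *)
Lemma torus_character_sum (b m0 : monom s) :
  \sum_(x : {ffun 'I_n -> K} | [forall j, x j != 0])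
     \prod_j x j ^+ (matvec A b j + #|K|.-2 * matvec A m0 j)
  = if toric_congr #|K|.-1 A b m0 then (-1) ^+ n else 0.
Proof.
rewrite torus_monomial_sum.
under eq_bigr do rewrite unit_power_sumE dvdn_add_pred_mul ?card_pred_gt0 //.
have [/forallP congr_b | /forallPn[j ncongr]] := boolP (toric_congr #|K|.-1 A b m0).
  by rewrite (eq_bigr (fun _ => -1)) ?prodr_const ?card_ord // => j _; rewrite congr_b.
by rewrite (bigD1 j) //= (negbTE ncongr) mul0r.
Qed.

Lemma vanishing_congr_sum (F : mpoly K s) (m0 : monom s) :
  (forall x : 'I_n -> K, (forall j, x j != 0) -> meval F (torus_point x) = 0) ->
  \sum_(t <- F | toric_congr #|K|.-1 A t.2 m0) t.1 = 0.
Proof.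
move=> F_vanishes.
pose inv_char (x : 'I_n -> K) := \prod_j x j ^+ (#|K|.-2 * matvec A m0 j).
have average0 : \sum_(x : {ffun 'I_n -> K} | [forall j, x j != 0])
    meval F (torus_point x) * inv_char x = 0.
  by apply: big1 => x /forallP x_unit; rewrite F_vanishes // mul0r.
have : (-1) ^+ n * \sum_(t <- F | toric_congr #|K|.-1 A t.2 m0) t.1 = 0.
  rewrite -[RHS]average0 /meval; under [RHS]eq_bigr do rewrite mulr_suml.
  rewrite [RHS]exchange_big /= mulr_sumr big_mkcond; apply: eq_bigr => t _.
  rewrite (eq_bigr (fun x : {ffun 'I_n -> K} => t.1 * \prod_j
    x j ^+ (matvec A t.2 j + #|K|.-2 * matvec A m0 j))); last first.
    move=> x _; rewrite -mulrA torus_point_monomial -big_split /=.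
    by congr (_ * _); apply: eq_bigr => j _; rewrite exprD.
  by rewrite -mulr_sumr torus_character_sum; case: ifP; rewrite ?mulr0 // mulrC.
by move/eqP; rewrite mulf_eq0 signr_eq0 /= => /eqP.
Qed.

(* homogeneity splits the previous sums by degree *)
Lemma vanishing_homog_balanced (F : mpoly K s) : mhomog F ->
  (forall x : 'I_n -> K, (forall j, x j != 0) -> meval F (torus_point x) = 0) ->
  balanced #|K|.-1 A F.
Proof.
move=> [dg F_homog] F_vanishes m0.
have off_degree (Q : pred (monom s)) : (forall m, Q m -> mdeg m != dg) ->
    \sum_(t <- F | Q t.2) t.1 = 0.
  move=> Q_off; rewrite sum_terms_mcoef big1_seq // => m /andP[/Q_off deg_m _].
  by apply/eqP; apply: contraNT deg_m => /F_homog ->.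
have [deg_m0 | deg_m0] := eqVneq (mdeg m0) dg; last first.
  by apply: (off_degree (toric_equiv #|K|.-1 A ^~ m0)) => m /andP[/eqP ->].
have := vanishing_congr_sum m0 F_vanishes.
rewrite (bigID (fun t : K * monom s => mdeg t.2 == mdeg m0)) /=.
rewrite (off_degree
  (fun m => toric_congr #|K|.-1 A m m0 && (mdeg m != mdeg m0))); last first.
  by move=> m /andP[_]; rewrite deg_m0.
rewrite addr0 (eq_bigl (fun t : K * monom s => toric_equiv #|K|.-1 A t.2 m0)) //.
by move=> t; rewrite /toric_equiv andbC.
Qed.

Lemma toric_binomial_vanishes (g : mpoly K s) :
  toric_binomial #|K|.-1 A g ->
  mhomog g /\
  forall x : 'I_n -> K, (forall j, x j != 0) -> meval g (torus_point x) = 0.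
Proof.
move=> [a [/andP[/eqP deg_a /forallP congr_a] ->]]; split.
  exists (mdeg (posp a)) => m; rewrite mcoef_pair.
  have [<- //|_] := eqVneq (posp a) m.
  by have [<- _|_] := eqVneq (negp a) m; rewrite ?deg_a // addr0 eqxx.
move=> x x_unit; rewrite /meval /mbinom !big_cons big_nil /= !torus_point_monomial.
rewrite (eq_bigr (fun j => x j ^+ matvec A (negp a) j)).
  by rewrite mul1r mulN1r addr0 subrr.
by move=> j _; rewrite (expf_modn _ (x_unit j)) (eqP (congr_a j)) -expf_modn.
Qed.

End TorusSums.

Section Clutters.
Variables (K : finFieldType) (n s : nat) (E : 'I_s -> {set 'I_n}).

Lemma xpow_torus_point (x : 'I_n -> K) : xpow E x =1 torus_point (incidence E) x.
Proof.
move=> i; rewrite /xpow /torus_point big_mkcond /=; apply: eq_bigr => j _.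
by rewrite mxE; case: (j \in E i).
Qed.

Lemma binom_gen_toric (g : mpoly K s) :
  binom_gen E g <-> toric_binomial #|K|.-1 (incidence E) g.
Proof.
split=> [[a [congr_a [deg_a ->]]] | [a [/andP[/eqP deg_a /forallP congr_a] ->]]].
  exists a; split=> //; rewrite /toric_equiv deg_a eqxx /=.
  by apply/forallP => j; apply/eqP/congr_a.
by exists a; split=> [j|]; [apply/eqP/congr_a | split].
Qed.

Lemma IX_gen_balanced (F : mpoly K s) :
  IX_gen E F -> balanced #|K|.-1 (incidence E) F.
Proof.
move=> [F_homog F_vanishes]; apply: vanishing_homog_balanced => // x x_unit.
by rewrite -(eq_meval F (xpow_torus_point x)) F_vanishes.
Qed.

Lemma binom_gen_IX_gen (g : mpoly K s) : binom_gen E g -> IX_gen E g.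
Proof.
move=> /binom_gen_toric /toric_binomial_vanishes[g_homog g_vanishes].
by split=> // x x_unit; rewrite (eq_meval g (xpow_torus_point x)) g_vanishes.
Qed.

End Clutters.

Theorem proposition4p3 (K : finFieldType) (n s : nat)
  (E : 'I_s -> {set 'I_n}) :
  #|K| != 2 -> (2 <= s)%N -> is_clutter E ->
  forall f : mpoly K s,
    vanishing_ideal E f <-> in_ideal (binom_gen E) f.
Proof.
move=> _ _ _ f; split; last exact/in_ideal_mono/binom_gen_IX_gen.
move=> [l [IX_l eq_f]].
have balanced_l : balanced #|K|.-1 (incidence E) (mcomb l).
  by apply: balanced_mcomb => hg /IX_l /IX_gen_balanced.
apply: in_ideal_meq eq_f; apply: in_ideal_mono (balanced_in_ideal balanced_l).
by move=> g /binom_gen_toric.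
Qed.
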